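(* Let $\mathbb{K}$ be a field and let $\mathcal{G}$ be a second-countable ample groupoid such that $\mathcal{G}^{(0)}$ is Hausdorff. Suppose that $\mathcal{G}$ is minimal, that $\mathcal{G}$ is effective, and that every compact open subset of $\mathcal{G}$ is regular open. Then $A_{\mathbb{K}}(\mathcal{G})$ is simple.
   Context: All groupoids are topological groupoids $\mathcal{G}$ with unit space $\mathcal{G}^{(0)}$ and range and source maps $r,s$; they are locally compact but not necessarily Hausdorff, and ''compact'' does not presuppose Hausdorff. An open bisection is an open set $B\subseteq\mathcal{G}$ such that $r$ and $s$ each restrict to a homeomorphism of $B$ onto an open subset of $\mathcal{G}^{(0)}$. $\mathcal{G}$ is étale if its topology has a basis of open bisections, and ample if its topology has a basis of compact open bisections. The isotropy bundle is $\operatorname{Iso}(\mathcal{G})=\{\gamma\in\mathcal{G}: r(\gamma)=s(\gamma)\}$; $\mathcal{G}$ is effective if the interior of $\operatorname{Iso}(\mathcal{G})$ equals $\mathcal{G}^{(0)}$. $\mathcal{G}$ is minimal if for every $u\in\mathcal{G}^{(0)}$ the orbit $[u]=s(r^{-1}(u))$ is dense in $\mathcal{G}^{(0)}$. A subset of a topological space is regular open if it equals the interior of its closure. For an ample groupoid with Hausdorff unit space, the Steinberg algebra $A_{\mathbb{K}}(\mathcal{G})$ is the $\mathbb{K}$-linear span of the characteristic functions $1_B:\mathcal{G}\to\mathbb{K}$ of compact open bisections $B$, with pointwise addition and scalar multiplication and convolution product $f*g(\gamma)=\sum_{r(\eta)=r(\gamma)}f(\eta)g(\eta^{-1}\gamma)$.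 It is simple if its only two-sided ideals are $0$ and itself. *)

(* Defs.v *)
From HB Require Import structures.
From mathcomp Require Import all_boot all_order all_algebra.
From mathcomp Require Import boolp classical_sets functions cardinality fsbigop.
From mathcomp Require Import topology numfun.

Set Implicit Arguments.
Unset Strict Implicit.
Unset Printing Implicit Defensive.

Import GRing.Theory.
Local Open Scope classical_set_scope.
Local Open Scope ring_scope.

(* Units are identified with the corresponding identity arrows, so the range
   and source of an arrow are again arrows. [gmul] is total, but only the values
   [gmul x y] with [gsource x = grange y] are meaningful. *)
HB.mixin Record isGroupoid G := {
  grange : G -> G;
  gsource : G -> G;
  ginv : G -> G;
  gmul : G -> G -> G;
  grange_range : forall x, grange (grange x) = grange x;
  gsource_range : forall x, gsource (grange x) = grange x;
  grange_source : forall x, grange (gsource x) = gsource x;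
  gsource_source : forall x, gsource (gsource x) = gsource x;
  grangeM : forall x y, gsource x = grange y -> grange (gmul x y) = grange x;
  gsourceM : forall x y, gsource x = grange y -> gsource (gmul x y) = gsource y;
  gmulA : forall x y z, gsource x = grange y -> gsource y = grange z ->
    gmul x (gmul y z) = gmul (gmul x y) z;
  gmul_range : forall x, gmul (grange x) x = x;
  gmul_source : forall x, gmul x (gsource x) = x;
  grangeV : forall x, grange (ginv x) = gsource x;
  gsourceV : forall x, gsource (ginv x) = grange x;
  gmulV : forall x, gmul x (ginv x) = grange x;
  gmulVl : forall x, gmul (ginv x) x = gsource x
}.

#[short(type="groupoidType")]
HB.structure Definition Groupoid := {G of isGroupoid G}.

(* Continuity of [grange] and [gsource] follows from [gmulV] and [gmulVl]. *)
HB.mixin Record isTopologicalGroupoid G of Topological G & Groupoid G := {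
  ginv_continuous : continuous (@ginv G);
  gmul_continuous :
    {within [set p : G * G | gsource p.1 = grange p.2],
      continuous (fun p : G * G => gmul p.1 p.2)}
}.

#[short(type="topologicalGroupoidType")]
HB.structure Definition TopologicalGroupoid :=
  {G of Topological G & Groupoid G & isTopologicalGroupoid G}.

Definition homeo_onto (T U : topologicalType) (A : set T) (B : set U)
    (f : T -> U) : Prop :=
  [/\ set_bij A B f, {within A, continuous f} &
      exists2 g : U -> T, {in A, cancel f g} & {within B, continuous g}].

Section Groupoids.
Context (G : topologicalGroupoidType).

(* As a type, this set carries the subspace topology. *)
Definition unit_space : set G := range grange.

Definition isotropy : set G := [set x | grange x = gsource x].

Definition gorbit (u : G) : set G := gsource @` [set x | grange x = u].

Definition open_bisection (B : set G) : Prop :=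
  open B /\ forall f : G -> G, f = grange \/ f = gsource ->
    homeo_onto B (f @` B) f /\
    open (set_val @^-1` (f @` B) : set unit_space).

Definition ample : Prop := basis [set B | compact B /\ open_bisection B].

Definition effective : Prop := interior isotropy = unit_space.

Definition minimal : Prop := forall u, unit_space u ->
  dense (set_val @^-1` gorbit u : set unit_space).

(* Local compactness, in the sense suited to non-Hausdorff spaces, is automatic
   for ample groupoids. ([locally_compact] asks for closed compact
   neighbourhoods, which is too strong here.) *)
Lemma ample_nbhs_compact (x : G) (U : set G) : ample -> nbhs x U ->
  exists2 C : set G, nbhs x C /\ compact C & C `<=` U.
Proof.
move=> [Bop cvgB] /(cvgB x) [B [BB Bx] BU]; exists B => //.
by split; [exact: open_nbhs_nbhs (conj (Bop _ BB) Bx) | case: BB].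
Qed.

End Groupoids.

Arguments unit_space : clear implicits.
Arguments isotropy : clear implicits.

Section SteinbergAlgebra.
Context (K : fieldType) (G : topologicalGroupoidType).

Definition steinberg : set (G -> K) :=
  [set f | exists (n : nat) (c : 'I_n -> K) (B : 'I_n -> set G),
    (forall i, compact (B i) /\ open_bisection (B i)) /\
    f = (fun x => \sum_(i < n) c i * \1_(B i) x)].

(* The sum has finite support when [f] belongs to [steinberg]. *)
Definition convolution (f g : G -> K) : G -> K :=
  fun x => \sum_(y \in [set y : G | grange y = grange x])
    f y * g (gmul (ginv y) x).

Definition steinberg_ideal (I : set (G -> K)) : Prop :=
  [/\ I `<=` steinberg, I 0,
      (forall f g, I f -> I g -> I (f - g)) &
      (forall a f, steinberg a -> I f ->
         I (convolution a f) /\ I (convolution f a))].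

Definition steinberg_simple : Prop := forall I : set (G -> K),
  steinberg_ideal I -> I = [set 0] \/ I = steinberg.

End SteinbergAlgebra.

Arguments steinberg : clear implicits.

(* Main.v *)
Require Import Defs.
From mathcomp Require Import all_boot all_order all_algebra.
From mathcomp Require Import boolp classical_sets functions topology.
From mathcomp Require Import fsbigop numfun.

(* Let I be an ideal containing some f with f(x) <> 0. Regular openness makes f
   constant, with value f(x), on a nonempty open set: intersect the bisections of
   an expression of f that contain x, and remove the closure of the union of the
   others. Translating by a bisection makes f constant on a nonempty open set V
   of units. Effectiveness and the Hausdorff unit space allow V to be shrunk until
   the bisections supporting f contain no arrow with both ends in V other than
   units, so that 1_V * f * 1_V is a nonzero multiple of 1_V. By minimality every
   unit then has a neighbourhood U with 1_U in I, and finitely many such U cover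
   the range of any compact open bisection B, whence 1_B is in I. *)

Set Implicit Arguments.
Unset Strict Implicit.
Unset Printing Implicit Defensive.

Import GRing.Theory.
Local Open Scope classical_set_scope.
Local Open Scope ring_scope.

(** If no member of [P] covers [A], the sets [A] minus [U] with [P U] generate a proper filter, by
    closure of [P] under unions. A cluster point of it in [A] has a neighbourhood in [P], whose
    complement belongs to the filter. No separation of points is involved. *)
Lemma compact_directed_cover (T : topologicalType) (A : set T)
    (P : set T -> Prop) :
  compact A -> P set0 -> (forall U V, P U -> P V -> P (U `|` V)) ->
  (forall x, A x -> exists2 U, nbhs x U & P U) -> exists2 U, P U & A `<=` U.
Proof.
move=> cptA P0 PU Aloc; apply: contrapT => noU.
pose F : set_system T := [set S | exists2 U, P U & A `\` U `<=` S].
have FF : ProperFilter F.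
  split.
    move=> [U PU' AU]; apply: noU; exists U => // x Ax.
    by apply: contrapT => nUx; exact: (AU x).
  split.
  - by exists set0.
  - move=> S1 S2 [U1 PU1 sub1] [U2 PU2 sub2].
    exists (U1 `|` U2); first exact: PU.
    move=> x [Ax /not_orP[nU1 nU2]].
    by split; [exact: sub1 | exact: sub2].
  - by move=> S1 S2 S12 [U PU' sub]; exists U => //; exact: subset_trans S12.
have FA : F A by exists set0 => // x [].
have [x [Ax clx]] := cptA F FF FA.
have [U Ux PUx] := Aloc x Ax.
have FnU : F (~` U) by exists U => // y [].
by have [y [/= nUy Uy]] := clx _ _ FnU Ux.
Qed.

(** * Cancellation laws in a groupoid *)

Section GroupoidTheory.
Context (G : groupoidType).
Implicit Types x y : G.

Lemma gmulKV x y : gsource x = grange y -> gmul (ginv x) (gmul x y) = y.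
Proof. by move=> xy; rewrite gmulA ?gsourceV // gmulVl xy gmul_range. Qed.

Lemma ginvK : involutive (@ginv G).
Proof.
move=> x; have := gmul_source (ginv (ginv x)).
by rewrite gsourceV grangeV => h; rewrite -h -gmulVl gmulKV ?gsourceV.
Qed.

Lemma gmulVKl x y : grange x = grange y -> gmul x (gmul (ginv x) y) = y.
Proof.
by move=> xy; have := @gmulKV (ginv x) y; rewrite ginvK; apply; rewrite gsourceV.
Qed.

Lemma ginv_id x : grange x = x -> ginv x = x.
Proof.
move=> xx; have sx : gsource x = x by rewrite -xx gsource_range.
by have := gmul_source (ginv x); rewrite gsourceV xx gmulVl sx.
Qed.

End GroupoidTheory.

(** * Units, bisections and the topology of the groupoid *)

Section TopologicalGroupoidTheory.
Context (G : topologicalGroupoidType).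
Implicit Types (x y u : G) (A B U V : set G).

Lemma unit_spaceP u : unit_space G u <-> grange u = u.
Proof.
by split => [[x _ <-]|<-]; [exact: grange_range | exists u].
Qed.

Lemma gsource_unit u : unit_space G u -> gsource u = u.
Proof. by move=> /unit_spaceP <-; rewrite gsource_range. Qed.

Lemma unit_grange x : unit_space G (grange x).
Proof. by exists x. Qed.

Lemma unit_gsource x : unit_space G (gsource x).
Proof. by apply/unit_spaceP; rewrite grange_source. Qed.

Lemma grange_continuous : continuous (@grange G).
Proof.
move=> x.
(* Multiplication is continuous only within the composable pairs, and every pair [(y, ginv y)] is
   composable. *)
have -> : @grange G = (fun p : G * G => gmul p.1 p.2) \o
    (fun y => (y, ginv y)) by apply/funext => y /=; rewrite gmulV.
have /subspace_continuousP/(_ (x, ginv x)) := @gmul_continuous G.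
rewrite /= grangeV => /(_ erefl) mulc S /mulc S_within.
have pairc : (fun y => (y, ginv y)) @ nbhs x --> nbhs (x, ginv x).
  by apply: cvg_pair => //; exact: ginv_continuous.
have := pairc _ S_within; rewrite !nbhs_filterE /fmap /=.
by apply: filterS => y; apply; rewrite /= grangeV.
Qed.

Lemma gsource_continuous : continuous (@gsource G).
Proof.
have -> : @gsource G = grange \o ginv by apply/funext => y /=; rewrite grangeV.
by move=> x; apply: continuous_comp;
  [exact: ginv_continuous | exact: grange_continuous].
Qed.

Lemma open_unit_preimage A : open A ->
  open (set_val @^-1` A : set (unit_space G)).
Proof. by move=> oA; exists A. Qed.

Lemma open_in_unit A : open (unit_space G) -> A `<=` unit_space G ->
  open (set_val @^-1` A : set (unit_space G)) -> open A.
Proof.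
move=> oU AU [O oO OA]; rewrite (_ : A = O `&` unit_space G); first exact: openI.
have OAE v (Uv : unit_space G v) : O v = A v.
  exact: (congr1 (fun S => S (SigSub (mem_set Uv))) OA).
rewrite predeqE => v; split => [Av|[Ov Uv]]; last by rewrite -OAE.
by split; [rewrite OAE//; exact: AU | exact: AU].
Qed.

Lemma bisection_grange_inj B x y : open_bisection B -> B x -> B y ->
  grange x = grange y -> x = y.
Proof.
move=> [_ /(_ grange (or_introl erefl))[[[_ inj _] _ _] _]] Bx By.
by apply: inj; exact/mem_set.
Qed.

Lemma bisection_gsource_inj B x y : open_bisection B -> B x -> B y ->
  gsource x = gsource y -> x = y.
Proof.
move=> [_ /(_ gsource (or_intror erefl))[[[_ inj _] _ _] _]] Bx By.
by apply: inj; exact/mem_set.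
Qed.

Lemma bisection_open_range B : open (unit_space G) -> open_bisection B ->
  open (grange @` B).
Proof.
move=> oU [_ /(_ grange (or_introl erefl))[_ oB]].
by apply: open_in_unit oB => // _ [x _ <-]; exact: unit_grange.
Qed.

Lemma compact_range B : compact B -> compact (grange @` B).
Proof.
move=> cB; apply: continuous_compact cB.
exact: continuous_subspaceT grange_continuous.
Qed.

Lemma image_ginv B : ginv @` B = ginv @^-1` B.
Proof.
rewrite predeqE => x; split => [[y By <-]|Bx]; first by rewrite /= ginvK.
by exists (ginv x); rewrite ?ginvK.
Qed.

(** Inversion is a homeomorphism exchanging range and source, so the condition for one map on the
    inverse of [B] is the condition for the other map on [B]. *)
Lemma bisection_inv B : open_bisection B -> open_bisection (ginv @` B).
Proof.
move=> [oB bB]; split.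
  rewrite image_ginv; apply: open_comp => // x _; exact: ginv_continuous.
move=> f fE.
have [f' [f'E ff']] : exists f' : G -> G,
    (f' = grange \/ f' = gsource) /\ f = f' \o ginv.
  case: fE => ->; [exists gsource | exists grange]; (split; first by [left|right]);
  by apply/funext => y /=; rewrite ?gsourceV ?grangeV.
have fB : f @` (ginv @` B) = f' @` B.
  by rewrite ff' image_comp; congr (_ @` _); apply/funext => y /=; rewrite ginvK.
rewrite fB ff'; have [[[hm hinj hsurj] fc [g gK gc]] oB'] := bB _ f'E.
split=> //; split.
- split.
  + by move=> _ [y By <-] /=; rewrite ginvK; exists y.
  + move=> _ _ /set_mem[y By <-] /set_mem[z Bz <-] /=; rewrite !ginvK => yz.
    by congr ginv; apply: hinj => //; exact/mem_set.
  + by move=> _ [y By <-]; exists (ginv y); [exists y | rewrite /= ginvK].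
- apply: continuous_subspaceT => y; apply: continuous_comp.
    exact: ginv_continuous.
  by case: f'E => ->; [exact: grange_continuous | exact: gsource_continuous].
exists (ginv \o g).
  move=> _ /set_mem[y By <-] /=; rewrite ginvK gK//; exact/mem_set.
by apply: within_continuous_comp => // y _; exact: ginv_continuous.
Qed.

Lemma compact_inv B : compact B -> compact (ginv @` B).
Proof.
move=> cB; apply: continuous_compact cB.
exact: continuous_subspaceT (@ginv_continuous G).
Qed.



Lemma ample_basis x A : ample G -> open A -> A x ->
  exists B, [/\ compact B, open_bisection B, B x & B `<=` A].
Proof.
move=> [_ cvgB] oA Ax.
by have [B [[cB bB] Bx] BA] := cvgB x A (open_nbhs_nbhs (conj oA Ax)); exists B.
Qed.

(** Disjoint open sets of the subspace are traces of open sets of [G] that may meet outside the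
    units. Cutting these down to the open unit space makes them disjoint in [G], which need not be
    Hausdorff. *)
Lemma unit_separation u v : open (unit_space G) ->
  hausdorff_space (unit_space G) -> unit_space G u -> unit_space G v ->
  u <> v -> exists A B, [/\ open A, open B, A u, B v & A `&` B `<=` set0].
Proof.
move=> oU; rewrite open_hausdorff => hU Uu Uv uv.
pose u' : unit_space G := SigSub (mem_set Uu).
pose v' : unit_space G := SigSub (mem_set Uv).
have [|[A' B'] /= [/set_mem Au /set_mem Bv]] := hU u' v'.
  by apply/eqP => /(congr1 val).
move=> [[A oA AA'] [B oB BB'] /eqP AB].
exists (A `&` unit_space G), (B `&` unit_space G); split.
- exact: openI.
- exact: openI.
- by split=> //; move: Au; rewrite -AA'.
- by split=> //; move: Bv; rewrite -BB'.
move=> w [[Aw Uw] [Bw _]].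
suff: (A' `&` B') (SigSub (mem_set Uw)) by rewrite AB.
by rewrite -AA' -BB'.
Qed.

(* Either [B] contains a unit of [V], or effectiveness provides an arrow of [B]
   with distinct endpoints in [V], which can be separated. *)
Lemma effective_shrink V B : ample G -> effective G -> hausdorff_space (unit_space G) ->
  open V -> V `<=` unit_space G -> V !=set0 -> open_bisection B ->
  exists W, [/\ open W, W `<=` V, W !=set0 &
    forall x, B x -> W (grange x) -> W (gsource x) -> unit_space G x].
Proof.
move=> ampG effG hU oV VU [v Vv] bB; have oB := bB.1.
have oU : open (unit_space G) by rewrite -effG; exact: open_interior.
have [[u [Vu Bu]]|VB0] := pselect (V `&` B !=set0).
  exists (V `&` B); split; [exact: openI | by move=> w [] | by exists u |].
  (* The unit [grange x] is itself an arrow of [B] with the same range as [x]. *)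
  move=> x Bx [Vr Br] _; suff -> : x = grange x by exact: unit_grange.
  by apply: bisection_grange_inj bB _ _ _ => //; rewrite grange_range.
pose BV := B `&` (grange @^-1` V `&` gsource @^-1` V).
have oBV : open BV.
  apply: openI => //; apply: openI; apply: open_comp => // x _.
    exact: grange_continuous.
  exact: gsource_continuous.
have [[x [Bx [rV sV]]]|BV0] := pselect (BV !=set0); last first.
  exists V; split => //; first by exists v.
  by move=> x Bx Vr Vs; case: BV0; exists x.
have [y [[By [ry sy]] nyy]] : exists y, BV y /\ grange y <> gsource y.
  apply: contrapT => noy; apply: VB0; exists x; split => //.
  have : interior (@isotropy G) x.
    rewrite /interior; apply: filterS (open_nbhs_nbhs (conj oBV _)) => //.
    by move=> z BVz; apply: contrapT => nz; apply: noy; exists z.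
  by rewrite effG => /unit_spaceP xx; rewrite -xx.
have [N1 [N2 [oN1 oN2 N1y N2y N12]]] := unit_separation oU hU
  (unit_grange y) (unit_gsource y) nyy.
have [|//|C [_ bC Cy CN]] := @ample_basis y
  (BV `&` (grange @^-1` N1 `&` gsource @^-1` N2)) ampG.
  apply: openI => //; apply: openI; apply: open_comp => // x' _.
    exact: grange_continuous.
  exact: gsource_continuous.
exists (grange @` C); split.
- exact: bisection_open_range.
- by move=> _ [z /CN[[_ [Vz _]] _] <-].
- by exists (grange y), y.
(* In [B], [z] and [z1] share their range, so they are equal and the source of [z] lies in [N2].
   That source is also the range of [z2], which lies in [N1]. *)
move=> z Bz [z1 Cz1 zz1] [z2 Cz2 zz2].
have [[Bz1 _] [_ N2z1]] := CN _ Cz1; have [_ [N1z2 _]] := CN _ Cz2.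
have z1z : z1 = z by exact: bisection_grange_inj bB _ _ _.
by case: (N12 (gsource z)); split; [rewrite -zz2 | rewrite -z1z].
Qed.

Lemma effective_shrink_all (n : nat) (B : 'I_n -> set G) V :
  ample G -> effective G -> hausdorff_space (unit_space G) ->
  open V -> V `<=` unit_space G -> V !=set0 ->
  (forall i, open_bisection (B i)) ->
  exists W, [/\ open W, W `<=` V, W !=set0 &
    forall i x, B i x -> W (grange x) -> W (gsource x) -> unit_space G x].
Proof.
move=> ampG effG hU; elim: n B V => [|n IHn] B V oV VU V0 bB.
  by exists V; split=> // -[].
have [W [oW WV W0 WB]] := IHn (fun i => B (lift ord0 i)) V oV VU V0
  (fun i => bB _).
have [W' [oW' W'W W'0 W'B]] := effective_shrink ampG effG hU oW
  (subset_trans WV VU) W0 (bB ord0).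
exists W'; split => //; first exact: subset_trans WV.
move=> i x; case: (unliftP ord0 i) => [j|] -> Bx Wr Ws; last exact: W'B Bx _ _.
exact: (WB j) Bx (W'W _ Wr) (W'W _ Ws).
Qed.

(** [W] need not contain [x], which may lie in the closure of the bisections that miss it; only the
    value [f x] has to persist on some nonempty open set. *)
Lemma steinberg_locally_constant (K : fieldType) (f : G -> K) x :
  (forall C : set G, compact C -> open C -> regopen C) ->
  steinberg K G f ->
  exists W, [/\ open W, W !=set0 & forall y, W y -> f y = f x].
Proof.
move=> regG [n [c [B [cbB ->]]]].
(* A union of bisections need not be a bisection, but it is compact and open, which is what regular
   openness is assumed for. *)
have big_compact (r : seq 'I_n) :
    compact (\big[setU/set0]_(i <- r | x \notin B i) B i) /\
    open (\big[setU/set0]_(i <- r | x \notin B i) B i).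
  apply: (big_ind (fun S => compact S /\ open S)).
  - by split; [exact: compact0 | exact: open0].
  - move=> S T [cS oS] [cT oT].
    by split; [exact: compactU | exact: openU].
  - by move=> i _; split; [exact: (cbB i).1 | exact: (cbB i).2.1].
set D := \big[setU/set0]_(i <- index_enum 'I_n | x \notin B i) B i.
pose U := \big[setI/setT]_(i < n | x \in B i) B i.
have oU : open U.
  apply: (big_ind open) => [|S T|i _]; [exact: openT | exact: openI |].
  exact: (cbB i).2.1.
have [cD oD] : compact D /\ open D := big_compact _.
have Ux : U x.
  by apply: (big_ind (fun S : set G => S x)) => // i /set_mem.
have nDx : ~ D x.
  rewrite /D; apply: (big_ind (fun S : set G => ~ S x)) => //.
    by move=> S T nS nT [].
  by move=> i /negP nB /mem_set.
exists (U `\` closure D); split.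
- by rewrite setDE; apply: openI => //; apply: closed_openC; exact: closed_closure.
(* If [U] lay inside the closure of [D], then [x] would be interior to that closure, that is, in
   [D]. *)
- apply: contrapT => noU; apply: nDx; rewrite -(regG D cD oD).
  apply: filterS (open_nbhs_nbhs (conj oU Ux)) => y Uy.
  by apply: contrapT => nDy; apply: noU; exists y.
move=> y [Uy nDy]; apply: eq_bigr => i _; congr (_ * _); rewrite !indicE.
congr ((nat_of_bool _)%:R); have [xi|xi] := boolP (x \in B i).
  apply/mem_set; move: Uy; rewrite /U (bigD1 i)//=; by case.
apply/negbTE/negP => /set_mem yi; apply: nDy; apply: subset_closure.
rewrite /D (bigD1 i)//=; by left.
Qed.

End TopologicalGroupoidTheory.

(** * Convolution with indicators of bisections and of sets of units *)

Section Convolution.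
Context (K : fieldType) (G : topologicalGroupoidType).
Implicit Types (f g : G -> K) (B U V : set G) (x u : G).

(** Vanishing away from [z] already makes the support finite, so the finitely supported sum takes
    its true value for arbitrary [f] and [g]. *)
Lemma convolution_single f g x z : grange z = grange x ->
  (forall y, grange y = grange x -> y <> z ->
     f y * g (gmul (ginv y) x) = 0) ->
  convolution f g x = f z * g (gmul (ginv z) x).
Proof.
move=> zx f0; rewrite /convolution -(@fsbig_widen _ _ _ _ [set z]).
- by rewrite fsbig_set1.
- by move=> _ ->.
- by move=> y [/= yx yz]; exact: f0.
Qed.

Lemma convolution_zero f g x :
  (forall y, grange y = grange x -> f y * g (gmul (ginv y) x) = 0) ->
  convolution f g x = 0.
Proof. exact: fsbig1. Qed.

Lemma indic_convolution B f x y : open_bisection B -> B y ->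
  grange y = grange x -> convolution \1_B f x = f (gmul (ginv y) x).
Proof.
move=> bB By yx; rewrite (convolution_single yx) ?indicE ?mem_set ?mul1r//.
move=> z zx nzy; rewrite indicE memNset ?mul0r// => Bz; apply: nzy.
by apply: bisection_grange_inj bB _ _ _ => //; rewrite yx.
Qed.

Lemma unit_convolution U f x : U `<=` unit_space G ->
  convolution \1_U f x = \1_U (grange x) * f x.
Proof.
move=> UU; rewrite (@convolution_single _ _ _ (grange x)) ?grange_range//.
  by rewrite ginv_id ?grange_range// gmul_range.
move=> y yx nyx; rewrite indicE memNset ?mul0r// => /UU/unit_spaceP yy.
by apply: nyx; rewrite -yx yy.
Qed.

Lemma convolution_unit U f x : U `<=` unit_space G ->
  convolution f \1_U x = f x * \1_U (gsource x).
Proof.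
move=> UU; rewrite (@convolution_single _ _ _ x)// ?gmulVl//.
move=> y yx nyx; rewrite [\1_U _]indicE memNset ?mulr0// => /UU/unit_spaceP yy.
apply: nyx; rewrite -[RHS](gmulVKl yx) -[LHS]gmul_source; congr gmul.
by rewrite -yy grangeM ?grangeV// gsourceV.
Qed.

(** Ideals are given by subtraction and convolution, so scalars will act on them through convolution
    with these functions. *)
Lemma steinberg_indic (c : K) B : compact B -> open_bisection B ->
  steinberg K G (fun x => c * \1_B x).
Proof.
move=> cB bB; exists 1%N, (fun=> c), (fun=> B); split=> //.
by apply/funext => x; rewrite big_ord1.
Qed.

Lemma steinberg_indic1 B : compact B -> open_bisection B ->
  steinberg K G \1_B.
Proof.
move=> cB bB; have -> : \1_B = (fun x => 1 * \1_B x) :> (G -> K).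
  by apply/funext => x; rewrite mul1r.
exact: steinberg_indic.
Qed.

Lemma indic_convolution_inv B : open_bisection B ->
  convolution \1_B \1_(ginv @` B) = \1_(grange @` B) :> (G -> K).
Proof.
move=> bB; apply/funext => x.
have [[y By yx]|nBx] := pselect ((grange @` B) (grange x)); last first.
  rewrite convolution_zero => [|y yx].
    rewrite indicE memNset// => -[y By yx].
    by apply: nBx; exists y; rewrite // -yx grange_range.
  by rewrite indicE memNset ?mul0r// => By; apply: nBx; exists y.
rewrite (indic_convolution _ bB By yx) !indicE; congr ((nat_of_bool _)%:R).
apply/idP/idP => /set_mem; rewrite ?image_ginv => H; apply/mem_set.
  have sy : gsource (ginv y) = grange x by rewrite gsourceV.
  (* Both sides lie in [B] and have the same source; the equality forces [x] to be the unit
     [grange y]. *)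
  have yH : y = ginv (gmul (ginv y) x).
    apply: (bisection_gsource_inj bB By H).
    by rewrite gsourceV grangeM// grangeV.
  exists y => //; rewrite -[RHS](gmulVKl yx) -[X in gmul _ X]ginvK -yH.
  by rewrite gmulV.
case: H => z Bz zx; have <- : z = y.
  by apply: (bisection_grange_inj bB) => //; rewrite yx -zx grange_range.
have -> : x = grange z by rewrite zx.
by rewrite /= -(gsourceV z) gmul_source ginvK.
Qed.

(** * Ideals of the Steinberg algebra *)

Lemma ideal_sub (I : set (G -> K)) f g : steinberg_ideal I -> I f -> I g ->
  I (fun x => f x - g x).
Proof. by move=> [_ _ IB _]; exact: IB. Qed.

Lemma ideal_add (I : set (G -> K)) f g : steinberg_ideal I -> I f -> I g ->
  I (fun x => f x + g x).
Proof.
move=> iI If Ig; have I0 : I 0 by case: iI.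
have -> : (fun x => f x + g x) = (fun x => f x - (0 x - g x)).
  by apply/funext => x; rewrite sub0r opprK.
by do 2 apply: ideal_sub => //.
Qed.

(** Inclusion-exclusion: on sets of units convolution is the pointwise product, so the indicator of
    the intersection is a convolution and stays in [I]. *)
Lemma ideal_unitU (I : set (G -> K)) U V : steinberg_ideal I ->
  U `<=` unit_space G -> V `<=` unit_space G ->
  I \1_U -> I \1_V -> I \1_(U `|` V).
Proof.
move=> iI UU VU IU IV.
have -> : \1_(U `|` V) =
    (fun x => \1_U x + \1_V x - convolution \1_U \1_V x) :> (G -> K).
  apply/funext => x; rewrite unit_convolution// !indicE.
  rewrite in_setU; have [xV|xV] := boolP (x \in V); last first.
    by rewrite orbF mulr0 subr0 addr0.
  have -> : grange x = x by apply/unit_spaceP/VU/set_mem.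
  by rewrite orbT mulr1 addrAC subrr add0r.
apply: ideal_sub => //; first exact: ideal_add.
have [IS _ _ Iconv] := iI; exact: (Iconv _ _ (IS _ IU) IV).1.
Qed.

Lemma ideal_indic_unit (I : set (G -> K)) f :
  ample G -> hausdorff_space (unit_space G) -> effective G ->
  (forall C : set G, compact C -> open C -> regopen C) ->
  steinberg_ideal I -> I f -> f <> 0 ->
  exists V, [/\ open V, V `<=` unit_space G, V !=set0 & I (\1_V)].
Proof.
move=> ampG hU effG regG [IS I0 IB Iconv] If f0.
have oU : open (unit_space G) by rewrite -effG; exact: open_interior.
have [x fx] : exists x, f x <> 0.
  apply: contrapT => no; apply: f0; apply/funext => x.
  by apply: contrapT => fx; apply: no; exists x.
have [W [oW [w Ww] Wf]] := steinberg_locally_constant x regG (IS _ If).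
have [B [cB bB Bw BW]] := ample_basis ampG oW Ww.
have cB' := compact_inv cB; have bB' := bisection_inv bB.
(* At the source of an arrow [b] of [B], [f'] takes the value [f b], which is [f x]; the set [V]
   below consists of these sources. *)
pose f' : G -> K := convolution \1_(ginv @` B) f.
have If' : I f' by case: (Iconv _ _ (steinberg_indic1 cB' bB') If).
pose V := grange @` (ginv @` B).
have oV : open V by exact: bisection_open_range.
have VU : V `<=` unit_space G by move=> _ [y _ <-]; exact: unit_grange.
have V0 : V !=set0 by exists (grange (ginv w)); exists (ginv w) => //; exists w.
have f'V u : V u -> f' u = f x.
  move=> [_ [b Bb <-] <-]; rewrite /f'.
  rewrite (@indic_convolution _ _ _ (ginv b))//; last by rewrite grange_range.
  by rewrite ginvK grangeV gmul_source; apply/Wf/BW.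
have [n [c [C [cbC f'E]]]] := IS _ If'.
have [W1 [oW1 W1V [w1 W1w1] W1C]] := effective_shrink_all ampG effG hU oV VU V0
  (fun i => (cbC i).2).
have [D [cD bD Dw1 DW1]] := ample_basis ampG oW1 W1w1.
have DV := subset_trans DW1 W1V; have DU := subset_trans DV VU.
exists D; split => //; [exact: bD.1 | by exists w1 |].
have SD := steinberg_indic1 cD bD.
have [_ Ifd] := Iconv _ _ SD If'.
have [Idfd _] := Iconv _ _ SD Ifd.
have [Id _] := Iconv _ _ (steinberg_indic (f x)^-1 cD bD) Idfd.
congr (I _): Id; apply/funext => y.
(* The left side vanishes unless both ends of [z] lie in [D]. Then any [C i] containing [z] forces
   [z] to be a unit, hence in [D]; so off [D] every term of [f'] is zero. *)
have key z : convolution \1_D (convolution f' \1_D) z = f x * \1_D z.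
  rewrite unit_convolution// convolution_unit//.
  have [Dz|nDz] := pselect (D z).
    have /unit_spaceP rz := DU _ Dz.
    rewrite rz (gsource_unit (DU _ Dz)) f'V; last exact: DV.
    by rewrite !indicE mem_set// mul1r.
  rewrite [in RHS]indicE (memNset nDz) mulr0.
  have [Dr|nDr] := pselect (D (grange z)); last by rewrite indicE memNset ?mul0r.
  have [Ds|nDs] := pselect (D (gsource z)); last first.
    by rewrite [\1_D (gsource z)]indicE memNset ?mulr0.
  rewrite f'E big1 ?mul0r ?mulr0// => i _; rewrite indicE memNset ?mulr0// => Ciz.
  apply: nDz; have /unit_spaceP <- // : unit_space G z.
  by apply: W1C Ciz _ _; exact: DW1.
rewrite (@convolution_single _ _ _ (grange y)) ?grange_range//.
  rewrite ginv_id ?grange_range// gmul_range key !indicE mulrACA.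
  rewrite mulVf ?mul1r; last exact/eqP.
  have [yD|_] := boolP (y \in D); last by rewrite mulr0.
  have /unit_spaceP -> := DU _ (set_mem yD).
  by rewrite yD mulr1.
move=> z zy nzy; rewrite [\1_D z]indicE memNset ?mulr0 ?mul0r// => /DU/unit_spaceP zz.
by apply: nzy; rewrite -zy zz.
Qed.

(** By minimality some arrow [x] runs between [u] and a point of [V]. For a small bisection [D]
    around it, all sources lie in [V], so [\1_D] is its own convolution with [\1_V] and lies in [I];
    convolving with the inverse of [D] gives the indicator of the range of [D]. *)
Lemma ideal_indic_local (I : set (G -> K)) V u :
  ample G -> open (unit_space G) -> minimal G -> steinberg_ideal I ->
  open V -> V `<=` unit_space G -> V !=set0 -> I \1_V -> unit_space G u ->
  exists U, [/\ nbhs u U, U `<=` unit_space G & I \1_U].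
Proof.
move=> ampG oU minG [_ _ _ Iconv] oV VU [v Vv] IV Uu.
have [|[v' Uv'] [/= Vv' [x xu xv']]] := minG u Uu _ _ (open_unit_preimage oV).
  by exists (SigSub (mem_set (VU _ Vv))).
have oVs : open (gsource @^-1` V).
  by apply: open_comp => // y _; exact: gsource_continuous.
have [|D [cD bD Dx DV]] := ample_basis (x := x) ampG oVs; first by rewrite /= xv'.
have ID : I \1_D.
  have [+ _] := Iconv _ _ (steinberg_indic1 cD bD) IV.
  congr (I _); apply/funext => y; rewrite convolution_unit// !indicE.
  have [Dy|_] := boolP (y \in D); last by rewrite mul0r.
  by rewrite mul1r mem_set//; apply/DV/set_mem.
exists (grange @` D); split.
- apply: open_nbhs_nbhs; split; first exact: bisection_open_range.
  by exists x.
- by move=> _ [y _ <-]; exact: unit_grange.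
rewrite -indic_convolution_inv//.
by case: (Iconv _ _ (steinberg_indic1 (compact_inv cD) (bisection_inv bD)) ID).
Qed.

End Convolution.

Theorem corollary3p16 (K : fieldType) (G : topologicalGroupoidType)
    (secondG : @second_countable G)
    (ampleG : ample G)
    (hausdorffG0 : hausdorff_space (unit_space G))
    (minimalG : minimal G)
    (effectiveG : effective G)
    (regularG : forall C : set G, compact C -> open C -> regopen C) :
  steinberg_simple K G.
Proof.
move=> I iI; have [IS I0 IB Iconv] := iI.
have oU : open (unit_space G) by rewrite -effectiveG; exact: open_interior.
have [[f [If f0]]|noI] := pselect (exists f, I f /\ f <> 0); last first.
  left; apply/seteqP; split => [f If|_ ->//].
  by apply: contrapT => f0; apply: noI; exists f.
right; apply/seteqP; split => // _ [n [c [B [cbB ->]]]].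
have [V [oV VU V0 IV]] :=
  ideal_indic_unit ampleG hausdorffG0 effectiveG regularG iI If f0.
have term i : I (fun x => c i * \1_(B i) x).
  have [cBi bBi] := cbB i.
  (* The sets of units with indicator in [I] are closed under unions, so one of them covers the
     compact range of [B i]; its indicator acts as a left identity on [\1_(B i)]. *)
  have [U [UU IU] BU] : exists2 U, U `<=` unit_space G /\ I \1_U &
      grange @` B i `<=` U.
    apply: (@compact_directed_cover _ _ (fun U => _ /\ _)).
    - exact: compact_range.
    - split; first exact: sub0set.
      by rewrite (_ : \1_set0 = 0)//; apply/funext => x; rewrite indicE in_set0.
    - move=> U1 U2 [UU1 IU1] [UU2 IU2].
      by split; [move=> x [/UU1|/UU2] | apply: ideal_unitU].
    - move=> _ [x _ <-].
      have [U [nU UU IU]] :=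
        ideal_indic_local ampleG oU minimalG iI oV VU V0 IV (unit_grange x).
      by exists U.
  have [_ +] := Iconv _ _ (steinberg_indic (c i) cBi bBi) IU.
  congr (I _); apply/funext => x; rewrite unit_convolution//.
  rewrite !indicE; have [Bx|_] := boolP (x \in B i); last by rewrite !mulr0.
  rewrite mem_set ?mul1r//.
  by apply: BU; exists x => //; exact: set_mem.
elim: n c B {cbB} term => [|n IHn] c B term.
  by rewrite (_ : (fun _ => _) = 0)//; apply/funext => x; rewrite big_ord0.
under eq_fun do rewrite big_ord_recl.
by apply: ideal_add => //; exact: IHn.
Qed.
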